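(* Let $\alpha>1$ be a real number. For every instance of makespan minimization with assignment constraints in which every job has processing time in $\{1,1/\alpha\}$, one can find in polynomial time a feasible schedule whose makespan is at most $$\min\left\{\,1+\frac{\lceil\alpha\rceil}{\alpha}-\frac{1}{\alpha},\ \ \frac{\alpha}{\lfloor\alpha\rfloor}+1-\frac{1}{\lfloor\alpha\rfloor}\,\right\}$$ times the optimal makespan.
   Context: Makespan minimization with assignment constraints: given a finite set $J$ of jobs and a finite set $M$ of machines, each job $j$ has a processing time $p_j$ and a set $M_j\subseteq M$ of machines on which it may be scheduled (assume a feasible schedule exists, i.e. each $M_j\neq\emptyset$). A feasible schedule assigns each job $j$ to a machine in $M_j$; the load of a machine is the sum of the processing times of jobs assigned to it, and the makespan is the maximum load over all machines. The goal is to minimize the makespan. *)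

(* Defs.v *)
From mathcomp Require Import all_boot all_order all_algebra.
From mathcomp Require Import reals.

Set Implicit Arguments.
Unset Strict Implicit.
Unset Printing Implicit Defensive.

Import Order.TTheory GRing.Theory Num.Theory.
Local Open Scope ring_scope.

(* Jobs and machines are numbered, so that an instance can be given as an
   input to a program. *)
Record instance (R : realType) := Instance {
  njobs : nat;
  nmachines : nat;
  ptime : 'I_njobs -> R;
  ptime_ge0 : forall j, 0 <= ptime j;
  elig : 'I_njobs -> {set 'I_nmachines};
  elig_neq0 : forall j, elig j != set0
}.

Arguments ptime {R} i _.
Arguments ptime_ge0 {R} i _.
Arguments elig {R} i _.
Arguments elig_neq0 {R} i _.

Section Scheduling.
Variables (R : realType) (I : instance R).

Definition schedule := {ffun 'I_(njobs I) -> 'I_(nmachines I)}.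

Definition feasible (s : schedule) : bool := [forall j, s j \in elig I j].

Definition load (s : schedule) (i : 'I_(nmachines I)) : R :=
  \sum_(j | s j == i) ptime I j.

(* Loads are nonnegative, so the default 0 does not affect the maximum. *)
Definition makespan (s : schedule) : R :=
  \big[Num.max/0]_(i < nmachines I) load s i.

Definition default_schedule : schedule :=
  [ffun j => xchoose (elimT (set0Pn _) (elig_neq0 I j))].

Lemma default_schedule_feasible : feasible default_schedule.
Proof. by apply/forallP => j; rewrite ffunE; apply: xchooseP. Qed.

(* [default_schedule] only witnesses that the set of feasible schedules is
   nonempty, which makes the minimum below meaningful. *)
Definition opt_makespan : R :=
  makespan [arg min_(s < default_schedule | feasible s) makespan s]%O.

Lemma opt_makespan_le s : feasible s -> opt_makespan <= makespan s.
Proof.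
rewrite /opt_makespan => fs.
by case: arg_minP => [|s0 _]; [exact: default_schedule_feasible | apply].
Qed.

Lemma opt_makespan_attained : exists2 s, feasible s & opt_makespan = makespan s.
Proof.
rewrite /opt_makespan.
case: arg_minP => [|s fs _]; first exact: default_schedule_feasible.
by exists s.
Qed.

(* The input word is [n; m], then one bit per job telling whether it is long
   (processing time 1), then the n x m eligibility matrix, row by row.  This
   determines the instance once the two possible processing times are fixed. *)
Definition encode : seq nat :=
  [:: njobs I; nmachines I]
  ++ [seq nat_of_bool (ptime I j == 1) | j <- enum 'I_(njobs I)]
  ++ [seq nat_of_bool (i \in elig I j)
       | j <- enum 'I_(njobs I), i <- enum 'I_(nmachines I)].

Definition encode_schedule (s : schedule) : seq nat :=
  [seq nat_of_ord (s j) | j <- enum 'I_(njobs I)].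

End Scheduling.

Arguments feasible {R} I s.
Arguments load {R} I s i.
Arguments makespan {R} I s.
Arguments encode_schedule {R} I s.

(* Model of computation: a structured random access machine.  The memory
   consists of arrays of natural numbers (a program names finitely many of
   them; a scalar is cell 0 of an array).  The only arithmetic is addition and
   truncated subtraction, each at unit cost: without multiplication a word has
   at most O(t) more bits after t steps, so polynomial time here is polynomial
   time on a Turing machine. *)
Local Open Scope nat_scope.

Inductive expr : Type :=
| Const of nat
| Get of nat & expr          (* array name, index *)
| Add of expr & expr
| Sub of expr & expr.

Inductive cmd : Type :=
| Skip
| Put of nat & expr & expr   (* array name, index, value *)
| Seq of cmd & cmd
| If of expr & cmd & cmd     (* nonzero means true *)
| While of expr & cmd.

Definition memory := nat -> nat -> nat.

Definition update (st : memory) (a i v : nat) : memory :=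
  fun a' i' => if (a' == a) && (i' == i) then v else st a' i'.

Fixpoint eval (st : memory) (e : expr) : nat :=
  match e with
  | Const n => n
  | Get a e1 => st a (eval st e1)
  | Add e1 e2 => eval st e1 + eval st e2
  | Sub e1 e2 => eval st e1 - eval st e2
  end.

Fixpoint ecost (e : expr) : nat :=
  match e with
  | Const _ => 1
  | Get _ e1 => (ecost e1).+1
  | Add e1 e2 | Sub e1 e2 => (ecost e1 + ecost e2).+1
  end.

(* [exec c st st' t]: started in [st], [c] halts in [st'] after [t] steps. *)
Inductive exec : cmd -> memory -> memory -> nat -> Prop :=
| exec_Skip st : exec Skip st st 1
| exec_Put a i e st :
    exec (Put a i e) st (update st a (eval st i) (eval st e))
         (ecost i + ecost e).+1
| exec_Seq c1 c2 st1 st2 st3 t1 t2 :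
    exec c1 st1 st2 t1 -> exec c2 st2 st3 t2 ->
    exec (Seq c1 c2) st1 st3 (t1 + t2)
| exec_IfT e c1 c2 st st' t :
    eval st e != 0 -> exec c1 st st' t ->
    exec (If e c1 c2) st st' (ecost e + t).+1
| exec_IfF e c1 c2 st st' t :
    eval st e = 0 -> exec c2 st st' t ->
    exec (If e c1 c2) st st' (ecost e + t).+1
| exec_WhileF e c st :
    eval st e = 0 -> exec (While e c) st st (ecost e).+1
| exec_WhileT e c st1 st2 st3 t1 t2 :
    eval st1 e != 0 -> exec c st1 st2 t1 -> exec (While e c) st2 st3 t2 ->
    exec (While e c) st1 st3 (ecost e + t1 + t2).+1.

(* The input is in array 0, all other cells being 0. *)
Definition init (input : seq nat) : memory :=
  fun a i => if a == 0 then nth 0 input i else 0.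

(* The output is read off the first cells of array 1. *)
Definition runs (c : cmd) (input output : seq nat) (t : nat) : Prop :=
  exists2 st, exec c (init input) st t &
    forall i, i < size output -> st 1 i = nth 0 output i.

(* A single program solves the search problem [good] on all inputs in [dom],
   in time polynomial in the length of the input. *)
Definition poly_time_solvable (X : Type) (dom : X -> Prop) (enc : X -> seq nat)
    (good : X -> seq nat -> Prop) : Prop :=
  exists (c : cmd) (k : nat), forall x, dom x ->
    exists (output : seq nat) (t : nat),
      [/\ runs c (enc x) output t, t <= k * size (enc x) ^ k + k
        & good x output].

(* Main.v *)
(* Let k be the floor or the ceiling of alpha, whichever gives the smaller
   bound, and count a long job as k units and a short job as one unit.

   Assign the units separately, minimizing the maximal number T of units on a
   machine; T is at most the makespan of any schedule for the sizes k and 1.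
   If machine i gets L_i long units, the long units exhibit a fractional
   assignment of the long jobs in which machine i carries at most
   c_i = ceil(L_i / k) of them, so by Hall's theorem the long jobs can be
   reassigned with at most c_i on machine i; the short jobs stay.  Since
   k c_i <= L_i + k - 1, a machine with a long and b short jobs satisfies
   k a + b <= T + k - 1, and b <= T if a = 0, whence the ratio.

   Both assignment problems are solved by an auction.  Each machine offers
   slots with initial prices; an unplaced item buys the cheapest slot on an
   eligible machine, evicting its owner, and the price goes up by one.  So the
   slot of an item is never dearer than any slot eligible for it by more than
   one.  When two levels of initial prices differ by more than the number of
   slots, some price in between is not taken, and an item placed at the upper
   level yields a set of items violating Hall's condition for the slots of the
   lower levels. *)
Require Import Defs.
From mathcomp Require Import all_boot all_order all_algebra.
From mathcomp Require Import reals.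
From mathcomp Require Import zify lra ring.

Import Order.TTheory GRing.Theory Num.Theory.
Local Open Scope nat_scope.

(** * Running time and total correctness of commands *)

(* Time bound for [c] provided that every loop is iterated at most X times
   whenever it is entered. *)
Fixpoint tm (X : nat) (c : cmd) : nat :=
  match c with
  | Skip => 1
  | Put _ i e => (ecost i + ecost e).+1
  | Seq c1 c2 => tm X c1 + tm X c2
  | If e c1 c2 => (ecost e + (tm X c1 + tm X c2)).+1
  | While e c1 => X * (ecost e + tm X c1).+1 + (ecost e).+1
  end.

Fixpoint csize (c : cmd) : nat :=
  match c with
  | Skip => 1
  | Put _ i e => (ecost i + ecost e).+1
  | Seq c1 c2 => csize c1 + csize c2
  | If e c1 c2 => (ecost e + (csize c1 + csize c2)).+1
  | While e c1 => ((ecost e).+1 + csize c1).*2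
  end.

Fixpoint depth (c : cmd) : nat :=
  match c with
  | Skip | Put _ _ _ => 0
  | Seq c1 c2 | If _ c1 c2 => maxn (depth c1) (depth c2)
  | While _ c1 => (depth c1).+1
  end.

Lemma tm_poly X c : tm X c <= csize c * X.+1 ^ depth c.
Proof.
elim: c => [|a i e|c1 IH1 c2 IH2|e c1 IH1 c2 IH2|e c IH] /=; rewrite ?expn0 ?muln1 //.
- rewrite mulnDl; apply: leq_add.
    by apply: leq_trans IH1 _; rewrite leq_mul2l leq_pexp2l ?leq_maxl ?orbT.
  by apply: leq_trans IH2 _; rewrite leq_mul2l leq_pexp2l ?leq_maxr ?orbT.
- rewrite -!addSn mulnDl; apply: leq_add; first by rewrite leq_pmulr ?expn_gt0.
  rewrite mulnDl; apply: leq_add.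
    by apply: leq_trans IH1 _; rewrite leq_mul2l leq_pexp2l ?leq_maxl ?orbT.
  by apply: leq_trans IH2 _; rewrite leq_mul2l leq_pexp2l ?leq_maxr ?orbT.
- rewrite expnS; have : 0 < X.+1 ^ depth c by rewrite expn_gt0.
  move: IH; set E := X.+1 ^ _; set S := csize c; set t := tm X c => IH E0.
  have h : (ecost e + t).+1 <= ((ecost e).+1 + S) * E by nia.
  rewrite -muln2; nia.
Qed.

Fixpoint writes (c : cmd) : seq nat :=
  match c with
  | Skip => [::]
  | Put a _ _ => [:: a]
  | Seq c1 c2 | If _ c1 c2 => writes c1 ++ writes c2
  | While _ c1 => writes c1
  end.

Definition same (W : seq nat) (st s : memory) : Prop :=
  forall a i, a \notin W -> s a i = st a i.

Lemma exec_same c st st' t : exec c st st' t -> same (writes c) st st'.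
Proof.
elim=> {c st st' t} //=.
- by move=> st a i e a' i'; rewrite inE /update => /negPf->.
- move=> c1 c2 st1 st2 st3 t1 t2 _ IH1 _ IH2 a i.
  by rewrite mem_cat negb_or => /andP[h1 h2]; rewrite IH2 // IH1.
- by move=> e c1 c2 st st' t _ _ IH a i; rewrite mem_cat negb_or => /andP[h1 h2]; exact: IH.
- by move=> e c1 c2 st st' t _ _ IH a i; rewrite mem_cat negb_or => /andP[h1 h2]; exact: IH.
- by move=> e c st1 st2 st3 t1 t2 _ _ IH1 _ IH2 a i h; rewrite IH2 // IH1.
Qed.

(** Total correctness with the time bound built in: since the bound is read off the syntax of [c],
    specifications only have to speak of states and of loop variants. *)
Definition wp (X : nat) (c : cmd) (Q : memory -> Prop) (st : memory) : Prop :=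
  exists st' t, [/\ exec c st st' t, t <= tm X c & Q st'].

(** Arrays not written keep their contents for syntactic reasons, so a specification need not
    mention them. *)
Lemma wp_frame X c Q st :
  wp X c (fun s => same (writes c) st s -> Q s) st -> wp X c Q st.
Proof.
move=> [s [t [ex lt q]]]; exists s, t; split=> //.
by apply: q; exact: exec_same ex.
Qed.

Lemma wp_mono X c (Q Q' : memory -> Prop) st :
  (forall s, Q s -> Q' s) -> wp X c Q st -> wp X c Q' st.
Proof. by move=> QQ' [s [t [ex lt q]]]; exists s, t; split=> //; exact: QQ'. Qed.

Lemma wp_skip X (Q : memory -> Prop) st : Q st -> wp X Skip Q st.
Proof. by move=> q; exists st, 1; split=> //; constructor. Qed.

Lemma wp_put X a i e (Q : memory -> Prop) st :
  Q (update st a (eval st i) (eval st e)) -> wp X (Put a i e) Q st.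
Proof. by move=> q; do 2 eexists; split; [constructor | | exact: q]. Qed.

Lemma wp_seq X c1 c2 Q st :
  wp X c1 (fun s => wp X c2 Q s) st -> wp X (Seq c1 c2) Q st.
Proof.
move=> [s1 [t1 [ex1 lt1 [s2 [t2 [ex2 lt2 q]]]]]].
by exists s2, (t1 + t2); split=> //=; [exact: exec_Seq ex1 ex2 | exact: leq_add].
Qed.

Lemma wp_if X e c1 c2 Q st :
  (eval st e != 0 -> wp X c1 Q st) -> (eval st e = 0 -> wp X c2 Q st) ->
  wp X (If e c1 c2) Q st.
Proof.
case: (eqVneq (eval st e) 0) => h h1 h2.
  have [s [t [ex lt q]]] := h2 h.
  by do 2 eexists; split; [exact: exec_IfF ex | move=> /=; lia |].
have [s [t [ex lt q]]] := h1 isT.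
by do 2 eexists; split; [exact: exec_IfT ex | move=> /=; lia |].
Qed.

Lemma wp_while X e c (Inv Q : memory -> Prop) (v : memory -> nat) st :
  Inv st -> v st <= X ->
  (forall s, Inv s -> eval s e != 0 ->
     wp X c (fun s' => Inv s' /\ v s' < v s) s) ->
  (forall s, Inv s -> eval s e = 0 -> Q s) ->
  wp X (While e c) Q st.
Proof.
move=> inv0 vX step post.
suff main N s : Inv s -> v s <= N -> exists s' t, [/\ exec (While e c) s s' t,
    t <= N * (ecost e + tm X c).+1 + (ecost e).+1 & Q s'].
  have [s [t [ex lt q]]] := main (v st) st inv0 (leqnn _).
  by exists s, t; split=> //=; apply: leq_trans lt _; rewrite leq_add2r leq_mul2r vX orbT.
elim: N s => [|N IH] s inv le; case: (eqVneq (eval s e) 0) => h.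
- by exists s, (ecost e).+1; split=> //; [exact: exec_WhileF | exact: post].
- by have [s' [t [_ _ [_]]]] := step s inv h; lia.
- by exists s, (ecost e).+1; split=> //; [exact: exec_WhileF | lia | exact: post].
have [s' [t [ex lt [inv' dec]]]] := step s inv h.
have [|s2 [t2 [ex2 lt2 q]]] := IH s' inv'; first lia.
exists s2; eexists; split; [exact: exec_WhileT ex ex2 | | done].
by rewrite mulSn; lia.
Qed.

(** * Scalars and counted loops *)

Definition Var (x : nat) : expr := Get x (Const 0).
Definition Set_ (x : nat) (e : expr) : cmd := Put x (Const 0) e.
Definition For (x : nat) (e : expr) (c : cmd) : cmd :=
  Seq (Set_ x (Const 0))
      (While (Defs.Sub e (Var x)) (Seq c (Set_ x (Add (Var x) (Const 1))))).

Lemma sameW W W' st s : {subset W <= W'} -> same W st s -> same W' st s.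
Proof. by move=> sub h a i ha; apply: h; apply: contra ha; exact: sub. Qed.

(** The bound [e] is evaluated again at every test, so its value has to survive the writes of the
    body. The invariant is asked for up to changes of array [x], which absorbs the update of the
    counter. *)
Lemma wp_for X x e c N (Inv : nat -> memory -> Prop) (Q : memory -> Prop) st :
  x \notin writes c -> N <= X ->
  (forall s, same (x :: writes c) st s -> eval s e = N) ->
  (forall s, same [:: x] st s -> Inv 0 s) ->
  (forall i s, i < N -> same (x :: writes c) st s -> s x 0 = i -> Inv i s ->
     wp X c (fun s' => forall s2, same [:: x] s' s2 -> Inv i.+1 s2) s) ->
  (forall s, same (x :: writes c) st s -> Inv N s -> Q s) ->
  wp X (For x e c) Q st.
Proof.
move=> xc NX eN inv0 step post; apply/wp_seq/wp_put => /=.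
set st0 := update _ _ _ _.
have fr0 : same [:: x] st st0 by move=> a i; rewrite inE /st0 /update => /negPf->.
pose J s := [/\ same (x :: writes c) st s, s x 0 <= N & Inv (s x 0) s].
apply: (@wp_while X _ _ J Q (fun s => N - s x 0)).
- rewrite /J; split.
  + by apply: sameW fr0 => a; rewrite !inE => ->.
  + by rewrite /st0 /update !eqxx.
  + by rewrite {1}/st0 /update !eqxx /=; exact: inv0.
- by apply: leq_trans NX; exact: leq_subr.
- move=> s [fr le inv] /=; rewrite (eN s fr) => ne.
  apply/wp_seq/wp_frame.
  have lt : s x 0 < N by lia.
  apply: wp_mono (step _ _ lt fr erefl inv) => s1 h fr1.
  apply: wp_put => /=.
  have ex : s1 x 0 = s x 0 by exact: fr1.
  have fr2 : same [:: x] s1 (update s1 x 0 (s1 x 0 + 1)).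
    by move=> a i; rewrite inE /update => /negPf->.
  have ev : update s1 x 0 (s1 x 0 + 1) x 0 = (s x 0).+1.
    by rewrite /update !eqxx /= ex addn1.
  rewrite /J ev; split; last lia.
  split=> //; last exact: h.
  move=> a i; rewrite inE negb_or => /andP[h1 h2].
  by rewrite fr2 ?inE // fr1 // fr // inE negb_or h1.
- move=> s [fr le inv] /=; rewrite (eN s fr) => h.
  by apply: post => //; have -> : N = s x 0 by lia.
Qed.

Lemma sum_update Z (g : nat -> nat) z0 v (f : nat -> nat) : z0 < Z ->
  \sum_(z < Z) f (if z == z0 :> nat then v else g z) + f (g z0)
  = \sum_(z < Z) f (g z) + f v.
Proof.
move=> lt; rewrite (bigD1 (Ordinal lt)) //= [in RHS](bigD1 (Ordinal lt)) //= eqxx.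
under eq_bigr => z; first by rewrite -val_eqE /= => /negPf->; over.
by lia.
Qed.

(** * Auction equilibria and violations of Hall's condition *)

Section Auction.
Variables (Z : nat) (mach : nat -> nat) (el : nat -> nat -> bool).
Variables (ini : nat -> nat) (valid : pred nat).

(* Owner 0 stands for a slot that nobody has bought. *)
Definition equil (own price : nat -> nat) : Prop :=
  forall z, z < Z ->
  if own z == 0 then price z = ini z else
  [/\ valid (own z), el (own z) (mach z), ini z < price z
    & forall z', z' < Z -> el (own z) (mach z') -> price z <= (price z').+1].

(** Prices only rise, so the inequalities of the other owners survive. The buyer takes a cheapest
    eligible slot, which afterwards is dearer than any other eligible one by at most one. *)
Lemma equil_step own price z0 x own' price' :
  equil own price -> x != 0 -> valid x -> z0 < Z -> el x (mach z0) ->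
  (forall z, z < Z -> el x (mach z) -> price z0 <= price z) ->
  (forall z, own' z = if z == z0 then x else own z) ->
  (forall z, price' z = if z == z0 then (price z0).+1 else price z) ->
  equil own' price'.
Proof.
move=> eq x0 vx lt ex mn Eo Ep z ltz; rewrite Eo Ep.
have mono z' : price z' <= price' z' by rewrite Ep; case: (eqVneq z' z0) => [->|].
case: (eqVneq z z0) => [->|ne].
  rewrite (negPf x0); split=> //.
    by have := eq z0 lt; case: eqP => [_ ->|_ []] //; lia.
  by move=> z' lt' e'; have := mn z' lt' e'; have := mono z'; lia.
have := eq z ltz; case: eqP => // _ [v e l h]; split=> // z' lt' e'.
by have := h z' lt' e'; have := mono z'; lia.
Qed.

(** Pigeonhole: [Z] slots cannot take all of the more than [Z] prices from [lo] to [hi - 1]. *)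
Lemma gap (price : nat -> nat) lo hi : lo + Z < hi ->
  exists2 l, lo <= l < hi & forall z, z < Z -> price z != l.
Proof.
move=> lt; pose s := [seq price z | z <- iota 0 Z].
have [/allP h|/allPn[l]] := boolP (all [in s] (iota lo (hi - lo))).
  have := uniq_leq_size (iota_uniq lo (hi - lo)) h.
  by rewrite !size_iota size_map size_iota; lia.
rewrite mem_iota => hl /negP nl; exists l; first lia.
move=> z ltz; apply/eqP => pl; apply: nl.
by rewrite /= -pl map_f // mem_iota.
Qed.

(* If no slot has price l, then the slots dearer than l that were cheap at the
   start, together with z0, are owned by items all of whose initially cheap
   slots are dearer than l: Hall's condition fails for these items. *)
Lemma overdemand own price lo hi z0 :
  equil own price -> lo + Z < hi -> z0 < Z -> own z0 != 0 -> hi <= ini z0 ->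
  exists X N : pred nat,
    [/\ X 0 = false, forall x i, X x -> el x i -> N i
      & \sum_(z < Z) ((ini z <= lo) && N (mach z)) < \sum_(z < Z) X (own z)].
Proof.
move=> eq lt lt0 ne0 hi0; have [l /andP[l1 l2] gp] := gap price lo hi lt.
pose s := own z0 :: [seq own z | z <- iota 0 Z & (ini z <= lo) && (l < price z)].
have sP x : x \in s -> exists z, [/\ z < Z, own z = x, x != 0 & l < price z].
  rewrite inE => /orP[/eqP->|/mapP[z]].
    exists z0; split=> //; have := eq z0 lt0; rewrite (negPf ne0) => -[_ _]; lia.
  rewrite mem_filter mem_iota => /andP[/andP[h1 h2] h3] ->; exists z; split=> //.
  by have := eq z h3; case: eqP => // _; lia.
pose N i := has (fun x => el x i) s.
exists [in s], N; split.
- by apply/negP => /sP[z []]; rewrite eqxx.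
- by move=> x i xs e; apply/hasP; exists x.
(* The owner [x] pays more than [l], hence by equilibrium any slot eligible for it costs at least
   [l], and more than [l] by the choice of [l]. An initially cheap slot of this kind has risen in
   price, so it is sold and its owner is listed in [s]. *)
have big z : z < Z -> ini z <= lo -> N (mach z) -> own z \in s.
  move=> ltz iz /hasP[x xs e].
  have [z1 [lt1 o1 x0 p1]] := sP x xs.
  have := eq z1 lt1; rewrite o1 (negPf x0) => -[_ _ _ /(_ z ltz e) h].
  have pz : l < price z by have := gp z ltz; lia.
  by rewrite inE map_f ?orbT // mem_filter iz pz mem_iota.
(* The slot [z0] is not initially cheap: it counts on the right only and makes the inequality
   strict. *)
rewrite (bigD1 (Ordinal lt0)) //= [X in _ < X](bigD1 (Ordinal lt0)) //=.
have -> : (ini z0 <= lo) = false by lia.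
rewrite /= inE eqxx add0n add1n ltnS; apply: leq_sum => z _.
by case: andP => // -[h1 h2]; rewrite big.
Qed.

(** More slots are eligible for [x] than are sold. The eligible unsold slot caps what [x] has to pay
    by an initial price, which keeps all prices bounded and makes the auction stop. *)
Lemma unsold_slot own price x K :
  equil own price -> \sum_(z < Z) (own z != 0) < K ->
  K <= \sum_(z < Z) el x (mach z) ->
  exists z, [/\ z < Z, el x (mach z) & price z = ini z].
Proof.
move=> eq lt le.
have [/existsP[z /andP[e o]]|/existsPn h] :=
  boolP [exists z : 'I_Z, el x (mach z) && (own z == 0)].
  by exists z; split=> //; have := eq z (ltn_ord z); rewrite o.
suff : \sum_(z < Z) el x (mach z) <= \sum_(z < Z) (own z != 0) by lia.
by apply: leq_sum => z _; have := h z; case: (el _ _) => //=; case: eqP.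
Qed.

End Auction.

(** * The auction as a program *)

(* Memory layout: 0 input, 1 output; indexed by slot: 2 owner (job number + 1),
   3 price, 4 machine; 5 address of the eligibility row (indexed by owner);
   6 long units on a machine still covered by its last free slot.  Scalars:
   7 number of slots, 8 bound on the initial prices, 9 gap between initial
   prices, 10 slots per machine, 13 item to place, 15 and 16 lowest price and
   its slot; 11, 12, 14, 18 loop counters; 17, 19, 20 temporaries. *)
Notation seqs := (foldr Seq Skip).

Definition scan : cmd :=
  For 14 (Var 7)
    (If (Get 0 (Add (Get 5 (Var 13)) (Get 4 (Var 14))))
       (If (Defs.Sub (Var 15) (Get 3 (Var 14)))
          (seqs [:: Set_ 15 (Get 3 (Var 14)); Set_ 16 (Var 14)])
          Skip)
       Skip).

(** Cell 15 starts as a sentinel price; an eligible slot below it guarantees that cell 16 gets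
    assigned. *)
Lemma wp_scan X st (E := fun z => st 0 (st 5 (st 13 0) + st 4 z) != 0) :
  st 7 0 <= X ->
  (exists z, [/\ z < st 7 0, E z & st 3 z < st 15 0]) ->
  wp X scan (fun s => [/\ s 16 0 < st 7 0, E (s 16 0)
    & forall z, z < st 7 0 -> E z -> st 3 (s 16 0) <= st 3 z]) st.
Proof.
move=> ZX [zz [zz1 zz2 zz3]].
pose Inv i (s : memory) := [/\ s 15 0 <= st 15 0,
  forall z, z < i -> E z -> s 15 0 <= st 3 z
  & s 15 0 = st 15 0 \/ [/\ s 16 0 < st 7 0, E (s 16 0) & st 3 (s 16 0) = s 15 0]].
apply: (wp_for _ _ _ _ (st 7 0) Inv) => //.
- by move=> s fr; rewrite /= fr.
- by move=> s fr; split=> //; [rewrite fr | left; rewrite fr].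
- move=> i s lt fr si [h1 h2 h3].
  have e0 : s 0 =1 st 0 by move=> a; exact: fr.
  have e3 : s 3 =1 st 3 by move=> a; exact: fr.
  have e4 : s 4 =1 st 4 by move=> a; exact: fr.
  have e5 : s 5 =1 st 5 by move=> a; exact: fr.
  have e13 : s 13 =1 st 13 by move=> a; exact: fr.
  have step s' : s' 15 0 <= s 15 0 -> (E i -> s' 15 0 <= st 3 i) ->
     (s' 15 0 = s 15 0 /\ s' 16 0 = s 16 0 \/
       [/\ s' 16 0 = i, E i & st 3 i = s' 15 0]) ->
     forall s2, same [:: 14] s' s2 -> Inv i.+1 s2.
    move=> le hE hd s2 fr2; rewrite /Inv !fr2 //; split; first exact: leq_trans h1.
      move=> z; rewrite ltnS leq_eqVlt => /orP[/eqP->|/h2 h e] //.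
      by apply: leq_trans le _; exact: h.
    by case: hd => [[-> ->]|[-> e1 e2]] //; right.
  apply: wp_if => /=; rewrite si e0 e5 e13 e4 => hE.
    apply: wp_if => /=; rewrite si e3 => hlt.
      do 2 apply/wp_seq/wp_put; apply/wp_skip => /=.
      apply: step; rewrite /update /= si e3 //; first lia.
      by right.
    by apply/wp_skip/step => //; [lia | left].
  apply/wp_skip/step => //; last by left.
  by rewrite /E hE.
- move=> s fr [h1 h2 [h3|[h3 h4 h5]]].
    by have := h2 zz zz1 zz2; lia.
  by split=> // z z1 z2; rewrite h5; exact: h2.
Qed.

(** The evicted owner becomes the next item to place. Owner 0 meaning an unsold slot, the loop stops
    at the first purchase that evicts nobody. *)
Definition insert : cmd :=
  While (Var 13)
    (seqs [:: Set_ 15 (Add (Var 8) (Const 1)); scan;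
              Set_ 17 (Get 2 (Var 16)); Put 2 (Var 16) (Var 13);
              Set_ 13 (Var 17);
              Put 3 (Var 16) (Add (Get 3 (Var 16)) (Const 1))]).

Section Insert.
Variables (X Z PM K : nat) (inp bs mach ini : nat -> nat).

Definition env (s : memory) : Prop :=
  [/\ s 0 =1 inp, s 5 =1 bs, s 4 =1 mach, s 7 0 = Z & s 8 0 = PM].

Definition el (x i : nat) : bool := inp (bs x + i) != 0.

Definition valid : pred nat := fun x => K <= \sum_(z < Z) el x (mach z).

Lemma env_same W st s :
  env st -> same W st s -> all (fun a => a \notin W) [:: 0; 5; 4; 7; 8] -> env s.
Proof.
move=> [e0 e5 e4 e7 e8] fr /and5P[h0 h5 h4 h7 /andP[h8 _]].
by split; move=> *; rewrite fr.
Qed.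

Hypothesis ZX : Z * PM.+2 <= X.
Hypothesis iniP : forall z, z < Z -> ini z <= PM.

Definition market (s : memory) : Prop :=
  equil Z mach el ini valid (s 2) (s 3) /\ forall z, z < Z -> s 3 z <= PM.+1.

(** The sums over all [f] vanishing at 0 encode the multiset of items that own slots: inserting adds
    one copy of the new item, whatever evictions happen on the way. *)
Lemma wp_insert st :
  env st -> market st -> st 13 0 != 0 -> valid (st 13 0) ->
  \sum_(z < Z) (st 2 z != 0) < K ->
  wp X insert (fun s => market s /\ forall f : nat -> nat, f 0 = 0 ->
    \sum_(z < Z) f (s 2 z) = \sum_(z < Z) f (st 2 z) + f (st 13 0)) st.
Proof.
move=> en mk x0 vx lt.
pose Inv (s : memory) := [/\ env s, market s, s 13 0 = 0 \/ valid (s 13 0)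
  & forall f : nat -> nat, f 0 = 0 ->
    \sum_(z < Z) f (s 2 z) + f (s 13 0) = \sum_(z < Z) f (st 2 z) + f (st 13 0)].
(* Each purchase raises one price by one and no price exceeds [PM.+1], so the total distance to this
   bound decreases. *)
apply: (wp_while _ _ _ Inv _ (fun s => \sum_(z < Z) (PM.+1 - s 3 z))).
- by split=> //; right.
- apply: leq_trans ZX; rewrite -[X in X * _]card_ord -sum_nat_const.
  by apply: leq_sum => z _; lia.
- move=> s [ens [eq pb] vs cnt] /= ne.
  have vs' : valid (s 13 0) by case: vs => // h; rewrite h in ne.
  have [e0 e5 e4 e7 e8] := ens.
  have [|z1 [z1Z z1e z1p]] := unsold_slot _ _ _ _ _ _ _ (s 13 0) K eq _ vs'.
    (* As long as an item is in hand, only exchanges have taken place, so the number of sold slots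
       is still the initial one. *)
    have h := cnt (fun x => x != 0) erefl.
    by move: h; rewrite /= ne x0 => /addIn->.
  apply/wp_seq/wp_put/wp_seq => /=; rewrite e8 /=.
  set s1 := update _ _ _ _.
  have fr1 : same [:: 15] s s1 by move=> a i; rewrite inE /s1 /update => /negPf->.
  have en1 : env s1 by exact: env_same fr1 isT.
  have [f0 f5 f4 f7 f8] := en1.
  have rd z : (s1 0 (s1 5 (s1 13 0) + s1 4 z) != 0) = el (s 13 0) (mach z).
    by rewrite f0 f5 f4 fr1.
  apply/wp_frame; apply: wp_mono (wp_scan X s1 _ _); first last.
  + exists z1; rewrite rd f7 fr1 //; split=> //.
    by rewrite z1p /s1 /update /=; have := iniP z1 z1Z; lia.
  + by rewrite f7; nia.
  rewrite f7 => s2 [z0Z /=]; rewrite rd => z0e z0mn fr2.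
  have {}z0mn z : z < Z -> el (s 13 0) (mach z) -> s 3 (s2 16 0) <= s 3 z.
    by move=> h1 h2; rewrite -!fr1 //; apply: z0mn => //=; rewrite rd.
  have z0PM : s 3 (s2 16 0) <= PM.
    by apply: leq_trans (z0mn _ z1Z z1e) _; rewrite z1p iniP.
  have fr3 a i : a \notin [:: 14; 15; 16] -> s2 a i = s a i.
    rewrite !inE !negb_or => /and3P[h14 h15 h16].
    by rewrite fr2 ?fr1 ?inE ?negb_or ?h14 ?h15 ?h16.
  set z0 := s2 16 0 in z0Z z0e z0mn z0PM *.
  do 4 apply/wp_seq/wp_put; apply: wp_skip => /=.
  set s3 := update _ _ _ _.
  have o3 z : s3 2 z = if z == z0 then s 13 0 else s 2 z.
    by rewrite /s3 /update /= -/z0; case: eqP => /= _; rewrite ?fr3.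
  have p3 z : s3 3 z = if z == z0 then (s 3 z0).+1 else s 3 z.
    by rewrite /s3 /update /= -/z0; case: eqP => /= _; rewrite !fr3 ?addn1.
  have c3 : s3 13 0 = s 2 z0 by rewrite /s3 /update /= -/z0 fr3.
  have en3 : env s3.
    have fr : same [:: 2; 3; 13; 14; 15; 16; 17] s s3.
      move=> a i; rewrite !inE !negb_or.
      move=> /and5P[/negPf h1 /negPf h2 /negPf h3 h4 /and3P[h5 h6 /negPf h7]].
      by rewrite /s3 /update h1 h2 h3 h7 /= fr3 // !inE !negb_or h4 h5 h6.
    exact: env_same fr isT.
  split; last first.
    rewrite (bigD1 (Ordinal z0Z)) //= [X in _ < X](bigD1 (Ordinal z0Z)) //=.
    rewrite p3 eqxx -addSn; apply: leq_add; first lia.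
    by apply: leq_sum => z /negPf; rewrite -val_eqE /= => h; rewrite p3 h.
  split=> //.
  + split; last by move=> z zl; rewrite p3; case: eqP => // _; exact: pb.
    exact: equil_step eq ne vs' z0Z z0e z0mn o3 p3.
  + rewrite c3; have := eq z0 z0Z; case: eqP => [->|_ [h _ _ _]]; first by left.
    by right.
  + move=> f f0'; rewrite c3 -cnt // -(sum_update Z (s 2) z0 (s 13 0) f z0Z).
    by congr (_ + _); apply: eq_bigr => z _; rewrite o3.
- move=> s [_ mks _ cnt] /= c0; split=> // f f0.
  by rewrite -cnt // c0 f0 addn0.
Qed.
End Insert.

(** The units of a job are items bearing the same number. The first auction is [phase k 1]; the
    second, [phase 1 0], places the long jobs only. *)
Definition phase (kl ks : nat) : cmd :=
  For 11 (Get 0 (Const 0))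
    (seqs [:: If (Get 0 (Add (Const 2) (Var 11)))
                 (Set_ 20 (Const kl)) (Set_ 20 (Const ks));
              For 12 (Var 20)
                (seqs [:: Set_ 13 (Add (Var 11) (Const 1)); insert])]).

Section Phase.
Variables (X Z PM K : nat) (inp bs mach ini : nat -> nat).
Hypothesis ZX : Z * PM.+2 <= X.
Hypothesis iniP : forall z, z < Z -> ini z <= PM.

Definition sold (F : (nat -> nat) -> nat) (s : memory) : Prop :=
  market Z PM K inp bs mach ini s /\
  forall f : nat -> nat, f 0 = 0 -> \sum_(z < Z) f (s 2 z) = F f.

Lemma sold_same W st s F : same W st s -> 2 \notin W -> 3 \notin W ->
  sold F st -> sold F s.
Proof.
move=> fr h2 h3 [[eq pb] cnt]; split; first split.
- move=> z /eq; rewrite !fr //; case: eqP => // _ [? ? ? h].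
  by split=> // z' *; rewrite fr // h.
- by move=> z zZ; rewrite fr // pb.
- by move=> f f0; rewrite -cnt //; apply: eq_bigr => z _; rewrite fr.
Qed.

Lemma sold_eq F F' s : (forall f, F f = F' f) -> sold F s -> sold F' s.
Proof. by move=> e [h1 h2]; split=> // f f0; rewrite -e h2. Qed.

Lemma wp_phase kl ks (wt := fun j => if inp j.+2 != 0 then kl else ks) st :
  env Z PM inp bs mach st ->
  (forall z, z < Z -> st 2 z = 0) -> (forall z, z < Z -> st 3 z = ini z) ->
  (forall j, j < inp 0 -> valid Z K inp bs mach j.+1) ->
  \sum_(j < inp 0) wt j <= K -> inp 0 <= X -> kl <= X -> ks <= X ->
  wp X (phase kl ks) (sold (fun f => \sum_(j < inp 0) wt j * f j.+1)) st.
Proof.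
move=> en own0 pr0 val wtK nX klX ksX.
pose F j (f : nat -> nat) := \sum_(j' < j) wt j' * f j'.+1.
apply: (wp_for _ _ _ _ (inp 0) (fun j => sold (F j))) => //.
- by move=> s fr /=; rewrite fr //; have [->] := en.
- move=> s fr; apply: sold_same fr isT isT _; split.
    split=> z zZ; first by rewrite own0 //= pr0.
    by rewrite pr0 //; apply: leq_trans (iniP z zZ) _.
  by move=> f f0; rewrite /F big_ord0 big1 // => z _; rewrite own0.
- move=> j s jn fr sj so.
  have ens : env Z PM inp bs mach s by exact: env_same en fr isT.
  have [e0 e5 e4 e7 e8] := ens.
  apply/wp_seq/(@wp_mono _ _ (fun s1 => [/\ same [:: 20] s s1 & s1 20 0 = wt j])).
    move=> s1 [fr1 wj]; apply/wp_seq.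
    have en1 : env Z PM inp bs mach s1 by exact: env_same ens fr1 isT.
    apply: (wp_for _ _ _ _ (wt j)
      (fun r => sold (fun f => F j f + r * f j.+1))) => //.
    + by rewrite /wt; case: ifP.
    + by move=> s2 fr2 /=; rewrite fr2.
    + move=> s2 fr2; apply: sold_same fr2 isT isT _.
      by apply: sold_same fr1 isT isT _; apply: sold_eq so => f; rewrite mul0n addn0.
    + move=> r s2 rw fr2 _ so2; have [mk2 cnt2] := so2.
      have s2j : s2 11 0 = j by rewrite fr2 // fr1.
      have en2 : env Z PM inp bs mach s2 by exact: env_same en1 fr2 isT.
      apply/wp_seq/wp_put => /=; rewrite s2j addn1.
      set s3 := update _ _ _ _.
      have fr3 : same [:: 13] s2 s3.
        by move=> a i; rewrite inE /s3 /update => /negPf->.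
      have [mk3 cnt3] := sold_same _ _ _ _ fr3 isT isT so2.
      apply: wp_seq; apply: wp_mono (wp_insert _ _ _ _ _ _ _ ini ZX iniP s3 _ mk3 _ _ _).
      * move=> s4 [mk4 cnt4]; apply: wp_skip => s5 fr5; apply: sold_same fr5 isT isT _.
        split=> // f f0; rewrite cnt4 // cnt3 // /s3 /update /= mulSn; lia.
      * exact: env_same en2 fr3 isT.
      * by [].
      * exact: val.
      (* The units sold so far are fewer than the total weight, because the current unit is not
         among them. *)
      * rewrite (cnt3 (fun x => x != 0)) //= muln1.
        apply: leq_trans wtK; rewrite -(subnKC jn) big_split_ord big_ord_recr /=.
        have -> : F j (fun x => x != 0) = \sum_(j' < j) wt j'.
          by apply: eq_bigr => i _; rewrite muln1.
        by rewrite -addnA ltn_add2l; exact: leq_trans rw (leq_addr _ _).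
    + move=> s2 fr2 so2; apply: wp_skip => s3 fr3; apply: sold_same fr3 isT isT _.
      by apply: sold_eq so2 => f; rewrite /F big_ord_recr.
  apply: wp_if => /=; rewrite sj e0 => h; apply: wp_put => /=; split.
  + by move=> a i; rewrite inE /update => /negPf->.
  + by rewrite /update /= /wt h.
  + by move=> a i; rewrite inE /update => /negPf->.
  + by rewrite /update /= /wt h.
Qed.
End Phase.

(** * Output, and preparation of the second auction *)

Definition out : cmd :=
  For 14 (Var 7)
    (If (Get 2 (Var 14))
       (Put 1 (Defs.Sub (Get 2 (Var 14)) (Const 1)) (Get 4 (Var 14))) Skip).

(** A job with several units gets the machine of one of them, a job without units keeps its entry.
    So the second call of [out] leaves the short jobs where the first one put them. *)
Lemma wp_out X st : st 7 0 <= X ->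
  wp X out (fun s => forall j,
    (exists z, [/\ z < st 7 0, st 2 z = j.+1 & s 1 j = st 4 z]) \/
    ((forall z, z < st 7 0 -> st 2 z != j.+1) /\ s 1 j = st 1 j)) st.
Proof.
move=> ZX.
pose Inv i (s : memory) := forall j,
    (exists z, [/\ z < i, st 2 z = j.+1 & s 1 j = st 4 z]) \/
    ((forall z, z < i -> st 2 z != j.+1) /\ s 1 j = st 1 j).
apply: (wp_for _ _ _ _ (st 7 0) Inv) => //.
- by move=> s fr; rewrite /= fr.
- by move=> s fr j; right; rewrite fr.
- move=> i s lt fr si inv.
  have e2 : s 2 =1 st 2 by move=> a; exact: fr.
  have e4 : s 4 =1 st 4 by move=> a; exact: fr.
  apply: wp_if => /=; rewrite si e2 => h.
    apply: wp_put => /=; rewrite si e2 e4 => s2 fr2 j.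
    rewrite fr2 // /update /=; case: eqP => [->|ne].
      by left; exists i; split=> //; lia.
    case: (inv j) => [[z [h1 h2 h3]]|[h1 h2]].
      by left; exists z; split=> //; lia.
    right; split=> // z; rewrite ltnS leq_eqVlt => /orP[/eqP->|/h1//].
    by lia.
  apply: wp_skip => s2 fr2 j; rewrite fr2 //.
  case: (inv j) => [[z [h1 h2 h3]]|[h1 h2]].
    by left; exists z; split=> //; lia.
  right; split=> // z; rewrite ltnS leq_eqVlt => /orP[/eqP->|/h1//].
  by rewrite h.
Qed.

(* Prepares the second auction: among the slots of a machine sold to long
   units, every k-th one becomes free, all other slots get price [Var 9]. *)
Definition convert (k : nat) : cmd :=
  For 14 (Var 7)
    (seqs [:: Put 3 (Var 14) (Var 9);
      If (Get 2 (Var 14))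
        (If (Get 0 (Add (Const 1) (Get 2 (Var 14))))
          (If (Get 6 (Get 4 (Var 14)))
             (Put 6 (Get 4 (Var 14))
                (Defs.Sub (Get 6 (Get 4 (Var 14))) (Const 1)))
             (seqs [:: Put 3 (Var 14) (Const 0);
                       Put 6 (Get 4 (Var 14)) (Const k.-1)]))
          Skip)
        Skip;
      Put 2 (Var 14) (Const 0)]).

Lemma wp_convert X k st (Z := st 7 0)
    (lg := fun z => (st 2 z != 0) && (st 0 (st 2 z).+1 != 0)) :
  Z <= X -> 0 < k -> st 9 0 != 0 -> (forall i, st 6 i = 0) ->
  wp X (convert k) (fun s =>
    [/\ forall z, z < Z -> s 2 z = 0,
        forall z, z < Z -> s 3 z = 0 \/ s 3 z = st 9 0
      & forall i : nat, \sum_(z < Z) ((st 4 z == i) && lg z)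
          <= k * \sum_(z < Z) ((st 4 z == i) && (s 3 z == 0))
          <= \sum_(z < Z) ((st 4 z == i) && lg z) + k.-1]) st.
Proof.
move=> ZX k0 B0 cr0.
(* A free slot pays for [k] long units, and [s 6 i] is the credit not yet used on machine [i]. As it
   stays below [k], the free slots number the ceiling of the long units divided by [k]. *)
pose Inv t (s : memory) :=
    [/\ forall z, s 2 z = if z < t then 0 else st 2 z,
        forall z, z < t -> s 3 z = 0 \/ s 3 z = st 9 0
      & forall i : nat, s 6 i <= k.-1 /\
          k * \sum_(z < t) ((st 4 z == i) && (s 3 z == 0)) =
          \sum_(z < t) ((st 4 z == i) && lg z) + s 6 i].
apply: (wp_for _ _ _ _ Z Inv) => //.
- by move=> s fr; rewrite /= fr.
- move=> s fr; split=> // [z|i]; first by rewrite fr.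
  by rewrite !big_ord0 fr // cr0 muln0.
- move=> t s tZ fr si [h2 h3 h6].
  have e0 : s 0 =1 st 0 by move=> a; exact: fr.
  have e4 : s 4 =1 st 4 by move=> a; exact: fr.
  have e9 : s 9 =1 st 9 by move=> a; exact: fr.
  have e2 : s 2 t = st 2 t by rewrite h2 ltnn.
  have step s1 : (forall z, s1 2 z = if z == t then 0 else s 2 z) ->
      (forall z, z != t -> s1 3 z = s 3 z) ->
      (s1 3 t = 0 \/ s1 3 t = st 9 0) ->
      (forall i, s1 6 i <= k.-1 /\
        k * ((st 4 t == i) && (s1 3 t == 0)) + s 6 i
          = ((st 4 t == i) && lg t) + s1 6 i) ->
      forall s2, same [:: 14] s1 s2 -> Inv t.+1 s2.
    move=> p2 p3 p3t p6 s2 fr2; split=> [z|z|i]; rewrite ?fr2 //.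
    - by rewrite p2 h2 ltnS [in RHS]leq_eqVlt; case: eqP.
    - rewrite ltnS leq_eqVlt; case: eqP => [->//|/eqP ne /=]; rewrite p3 //; exact: h3.
    - have [q1 q2] := p6 i; have [q3 q4] := h6 i; split=> //.
      rewrite !big_ord_recr /= mulnDr fr2 //.
      have -> : \sum_(z < t) ((st 4 z == i) && (s2 3 z == 0))
              = \sum_(z < t) ((st 4 z == i) && (s 3 z == 0)).
        apply: eq_bigr => z _; rewrite fr2 // p3 //; apply/eqP => e.
        by have := ltn_ord z; rewrite e ltnn.
      by rewrite q4 -!addnA [s 6 i + _]addnC q2. 
  apply/wp_seq/wp_put/wp_seq => /=.
  have B0' : (st 9 0 == 0) = false by exact: negPf.
  apply: wp_if; rewrite /update /= si e2 => ho; last first.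
    apply/wp_skip/wp_seq/wp_put/wp_skip/step; rewrite /update /= ?si ?e9 //.
    - by move=> z /negPf->.
    - by rewrite eqxx; right.
    - by move=> i; rewrite eqxx B0' /lg ho andbF muln0; have [] := h6 i.
  apply: wp_if; rewrite /update /= si e0 e2 => hl; last first.
    apply/wp_skip/wp_seq/wp_put/wp_skip/step; rewrite /update /= ?si ?e9 //.
    - by move=> z /negPf->.
    - by rewrite eqxx; right.
    - move=> i; rewrite eqxx B0' /lg ho add1n in hl *.
      by rewrite hl !andbF muln0; have [] := h6 i.
  have lgt : lg t by rewrite /lg ho; exact: hl.
  apply: wp_if; rewrite /update /= si e4 => hc.
    apply/wp_put/wp_seq/wp_put/wp_skip/step; rewrite /update /= ?si ?e9 ?e4 //.
    - by move=> z /negPf->.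
    - by rewrite eqxx; right.
    - move=> i; rewrite eqxx B0' lgt andbF andbT muln0 eq_sym.
      by have [q1 _] := h6 i; case: eqP => [e|_] //; rewrite e in hc *; split; lia.
  apply/wp_seq/wp_put/wp_seq/wp_put/wp_skip/wp_seq/wp_put/wp_skip/step;
    rewrite /update /= ?si ?e9 ?e4 //.
  - by move=> z /negPf ->.
  - by rewrite eqxx; left.
  - move=> i; rewrite eqxx lgt !andbT eq_sym.
    have [q1 _] := h6 i; case: eqP => [e|_]; rewrite ?muln0 ?muln1 //.
    by rewrite -e hc; split; lia.
- move=> s fr [h2 h3 h6]; split=> // [z zZ|i]; first by rewrite h2 zZ.
  by have [q1 ->] := h6 i; lia.
Qed.

(** * Initial slots and prices *)

(** Slots come in [n * k] levels, each with one slot per machine. Cell 9, the price step between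
    levels, exceeds the number of slots, as [overdemand] requires. Products are built up by repeated
    addition. *)
Definition setup (k : nat) : cmd :=
  seqs [:: Set_ 19 (Add (Const 2) (Get 0 (Const 0)));
    Set_ 9 (Const 1);
    For 11 (Get 0 (Const 0))
      (seqs [:: Put 5 (Add (Var 11) (Const 1)) (Var 19);
                Set_ 19 (Add (Var 19) (Get 0 (Const 1)));
                Set_ 9 (Add (Var 9) (iter k (Add (Get 0 (Const 1))) (Const 0)));
                Set_ 10 (Add (Var 10) (Const k))]);
    Set_ 8 (Var 9);
    For 12 (Var 10)
      (seqs [:: For 18 (Get 0 (Const 1))
                  (seqs [:: Put 4 (Var 7) (Var 18);
                            Put 3 (Var 7) (Var 8);
                            Set_ 7 (Add (Var 7) (Const 1))]);
                Set_ 8 (Add (Var 8) (Var 9))])].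

Lemma eval_iter_Add st k e : eval st (iter k (Add e) (Const 0)) = k * eval st e.
Proof. by elim: k => //= k ->; rewrite mulSn. Qed.

(** Without jobs the input length does not bound [m], whence the guarded hypothesis on [m]; the loop
    over machines is then never entered. *)
Lemma wp_setup X k st (n := st 0 0) (m := st 0 1) :
  (forall a i, a != 0 -> st a i = 0) ->
  n <= X -> n * k <= X -> (0 < n -> m <= X) ->
  wp X (setup k) (fun s =>
    [/\ forall j, j < n -> s 5 j.+1 = 2 + n + j * m,
        s 9 0 = (n * k * m).+1, s 7 0 = n * k * m, s 8 0 = (n * k).+1 * s 9 0
      & forall z, z < n * k * m -> s 4 z = z %% m /\ s 3 z = (z %/ m).+1 * s 9 0]) st.
Proof.
move=> st0 nX nkX mX.
do 2 apply/wp_seq/wp_put; apply: wp_seq => /=.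
set s0 := update _ _ _ _.
have fr0 : same [:: 9; 19] st s0.
  by move=> a i; rewrite !inE negb_or /s0 /update => /andP[/negPf-> /negPf->].
pose Inv j (s : memory) := [/\ s 19 0 = 2 + n + j * m, s 9 0 = (j * k * m).+1,
  s 10 0 = j * k & forall j', j' < j -> s 5 j'.+1 = 2 + n + j' * m].
apply: (wp_for _ _ _ _ n Inv) => //.
- by move=> s fr; rewrite /= fr // fr0.
- move=> s fr; split; rewrite ?fr //; last by rewrite fr0 // st0.
  by rewrite /s0 /update /= mul0n addn0.
- move=> j s jn fr sj [h19 h9 h10 h5].
  have s0j : s 0 =1 st 0 by move=> i; rewrite fr // fr0.
  do 4 apply/wp_seq/wp_put; apply/wp_skip => s2 fr2.
  rewrite /Inv !fr2 // /update /= sj ?s0j eval_iter_Add /= h19 h9 h10 ?s0j -/m.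
  split; try by rewrite !mulSn; lia.
  move=> j' lt; rewrite fr2 // /update /= sj h19 addn1 eqSS; case: eqP => [->//|ne].
  by apply: h5; lia.
move=> s fr [h19 h9 h10 h5].
have s0e : s 0 =1 st 0 by move=> i; rewrite fr // fr0.
apply/wp_seq/wp_put/wp_seq => /=; rewrite h9.
set B := (n * k * m).+1.
set s1 := update _ _ _ _.
have fr1 : same [:: 8] s s1 by move=> a i; rewrite inE /s1 /update => /negPf->.
have e9 : s1 9 0 = B by rewrite fr1.
pose Q i (s : memory) := forall z, z < i ->
  s 4 z = z %% m /\ s 3 z = (z %/ m).+1 * B.
pose J t (s : memory) := [/\ s 7 0 = t * m, s 8 0 = t.+1 * B & Q (t * m) s].
apply: (wp_for _ _ _ _ (n * k) J) => //.
- by move=> s2 fr2; rewrite /= fr2 // fr1.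
- move=> s2 fr2; split; last by [].
    by rewrite fr2 // fr1 // fr // fr0 // st0.
  by rewrite fr2 // /s1 /update /= mul1n.
- move=> t s2 tn fr2 _ [j7 j8 jQ].
  have n0 : 0 < n by case: (n) tn.
  have e0 : s2 0 =1 st 0 by move=> i; rewrite fr2 // fr1 // s0e.
  apply: wp_seq.
  pose J' i (s : memory) := s 7 0 = t * m + i /\ Q (t * m + i) s.
  apply: (wp_for _ _ _ _ m J') => //; first exact: mX.
  + by move=> s3 fr3; rewrite /= fr3 // e0.
  + by move=> s3 fr3; rewrite /J' addn0 fr3 //; split=> // z /jQ[]; rewrite !fr3.
  + move=> i s3 im fr3 s3i [q7 qQ].
    have e8 : s3 8 0 = t.+1 * B by rewrite fr3.
    do 3 apply/wp_seq/wp_put; apply/wp_skip => s4 fr4.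
    rewrite /J' /Q fr4 // /update /= q7 addn1 addnS; split=> // z.
    rewrite !fr4 // /update /= s3i q7 e8 ltnS leq_eqVlt.
    case: eqP => [->|ne /= /qQ//] _.
    by rewrite modnMDl modn_small // divnMDl ?(leq_ltn_trans _ im) // divn_small // addn0.
  + move=> s3 fr3 [q7 qQ]; have e8 : s3 8 0 = t.+1 * B by rewrite fr3.
    have e9' : s3 9 0 = B by rewrite fr3 // fr2.
    apply/wp_seq/wp_put/wp_skip => s4 fr4.
    rewrite /J /Q !fr4 // /update /= q7 e8 e9' mulSn addnC; split=> //.
      by rewrite [RHS]mulSn addnC.
    by move=> z zl; rewrite !fr4 //=; apply: qQ; rewrite addnC.
- move=> s2 fr2 [j7 j8 jQ]; have e9' : s2 9 0 = B by rewrite fr2.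
  apply: wp_skip; rewrite e9'; split=> // j jn.
  by rewrite fr2 // fr1 // h5.
Qed.

(** * Counting over slots *)

Lemma sum_grid K m (F : nat -> nat -> nat) :
  \sum_(z < K * m) F (z %/ m) (z %% m) = \sum_(t < K) \sum_(i < m) F t i.
Proof.
elim: K => [|K IH]; first by rewrite !big_ord0.
rewrite mulSn addnC big_split_ord /= IH [RHS]big_ord_recr /=; congr (_ + _).
apply: eq_bigr => i _; have m0 : 0 < m by apply: leq_ltn_trans (ltn_ord i).
by rewrite divnMDl // modnMDl modn_small // divn_small // addn0.
Qed.

Lemma sum_ord_eq m i : \sum_(i' < m) (i' == i :> nat) = (i < m).
Proof.
elim: m => [|m IH]; first by rewrite big_ord0.
by rewrite big_ord_recr /= IH ltnS [i <= m]leq_eqVlt eq_sym; case: ltngtP.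
Qed.

Lemma sum_ord_lt K t : \sum_(t' < K) (t' < t) = minn K t.
Proof.
elim: K => [|K IH]; first by rewrite big_ord0 min0n.
by rewrite big_ord_recr /= IH; case: ltnP; lia.
Qed.

Lemma sum_split_machine Z m (mach : nat -> nat) (F : nat -> nat) (N : pred nat) :
  (forall z, z < Z -> mach z < m) ->
  \sum_(z < Z) F z * N (mach z)
  = \sum_(i < m) N i * \sum_(z < Z) F z * (mach z == i).
Proof.
move=> mm; under [RHS]eq_bigr do rewrite big_distrr /=.
rewrite exchange_big /=; apply: eq_bigr => z _.
rewrite (bigD1 (Ordinal (mm _ (ltn_ord z)))) //= eqxx muln1 big1 ?addn0 1?mulnC //.
move=> i; rewrite -val_eqE /= eq_sym => /negPf->; by rewrite !muln0.
Qed.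

(** A slot has only one owner, so choosing a slot for each job is injective; the proof counts pairs
    of a job and a slot that it owns. *)
Lemma sum_le_owned n Z (own : nat -> nat) (P : pred nat) (Q : pred nat) :
  (forall j, j < n -> P j -> exists z, [/\ z < Z, own z = j.+1 & Q z]) ->
  \sum_(j < n) P j <= \sum_(z < Z) Q z.
Proof.
move=> H.
apply: (@leq_trans (\sum_(j < n) \sum_(z < Z) ((j.+1 == own z) && Q z))).
  apply: leq_sum => j _; case: (boolP (P j)) => // Pj.
  have [z [zZ oz qz]] := H j (ltn_ord j) Pj.
  by rewrite (bigD1 (Ordinal zZ)) //= oz eqxx qz.
rewrite exchange_big /=; apply: leq_sum => z _; case: (Q z); last first.
  by rewrite big1 // => j _; rewrite andbF.
under eq_bigr do rewrite andbT.
case: (own z) => [|x]; first by rewrite big1.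
by under eq_bigr do rewrite eqSS; rewrite sum_ord_eq; case: (_ < _).
Qed.

(** * Optimality of the first auction and rounding of the long jobs *)

Section Rounding.
Variables (n m k : nat) (e : nat -> nat -> bool) (lg : pred nat).

Definition assignment (h : nat -> nat) : Prop :=
  forall j, j < n -> h j < m /\ e j (h j).

Definition nlong (h : nat -> nat) (i : nat) : nat :=
  \sum_(j < n) (lg j && (h j == i)).

Definition nshort (h : nat -> nat) (i : nat) : nat :=
  \sum_(j < n) (~~ lg j && (h j == i)).

Let K := n * k.
Let Z := K * m.
Variables (mach : nat -> nat) (el : nat -> nat -> bool) (B : nat).
Hypothesis machE : forall z, z < Z -> mach z = z %% m.
Hypothesis elE : forall j i, j < n -> i < m -> el j.+1 i = e j i.
Hypothesis ZB : Z < B.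

Lemma mach_lt z : z < Z -> mach z < m.
Proof.
move=> h; rewrite machE // ltn_mod lt0n; apply/eqP => m0.
by move: h; rewrite /Z m0 muln0.
Qed.

Definition sells (own wt : nat -> nat) : Prop := forall f : nat -> nat,
  f 0 = 0 -> \sum_(z < Z) f (own z) = \sum_(j < n) wt j * f j.+1.

Lemma sells_count own wt j : sells own wt -> j < n ->
  \sum_(z < Z) (own z == j.+1) = wt j.
Proof.
move=> s jn; rewrite (s (fun x => x == j.+1)) //.
rewrite (bigD1 (Ordinal jn)) //= eqxx muln1 big1 ?addn0 // => i.
by rewrite -val_eqE eqSS /= => /negPf->; rewrite muln0.
Qed.

Lemma sells_ex own wt j : sells own wt -> j < n -> 0 < wt j ->
  exists2 z, z < Z & own z = j.+1.
Proof.
move=> s jn w0; have [/existsP[z /eqP h]|/existsPn h] :=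
  boolP [exists z : 'I_Z, own z == j.+1].
  by exists z.
by move: w0; rewrite -(sells_count own _ _ s jn) big1 // => z _; rewrite (negPf (h z)).
Qed.

(** [T] counts the levels up to the highest one in use, and a machine has one slot per level. A unit
    on the top level yields through [overdemand] a set of units larger than [T - 1] times the number
    of machines eligible for them, so every assignment loads some machine with [T] units. *)
Lemma units_opt own price valid (wt : nat -> nat) :
  equil Z mach el (fun z => (z %/ m).+1 * B) valid own price ->
  sells own wt ->
  exists T,
    (forall i : nat, \sum_(z < Z) ((own z != 0) && (mach z == i)) <= T) /\
    (0 < T -> forall h, assignment h ->
       exists2 i, i < m & T <= \sum_(j < n) wt j * (h j == i)).
Proof.
move=> eq s; pose T := \max_(z < Z | own z != 0) (z %/ m).+1; exists T.
have leT z : z < Z -> own z != 0 -> z %/ m < T.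
  by move=> zZ oz; rewrite /T (bigD1 (Ordinal zZ)) //= leq_maxl.
split.
  move=> i; apply: (@leq_trans (\sum_(z < Z) ((z %/ m < T) && (z %% m == i)))).
    apply: leq_sum => z _; rewrite machE //.
    by case: (boolP (own z != 0)) => // oz; rewrite leT.
  rewrite (sum_grid K m (fun t i' => (t < T) && (i' == i))).
  apply: leq_trans (geq_minr K T); rewrite -sum_ord_lt; apply: leq_sum => t _.
  by case: (t < T) => /=; [rewrite sum_ord_eq; case: (_ < _) | rewrite big1].
move=> T0 h ah.
have [z0 oz0 Tz0] : exists2 z0 : 'I_Z, own z0 != 0 & T = (z0 %/ m).+1.
  case: (pickP (fun z : 'I_Z => own z != 0)) => [z1 oz1|none].
    have [|z0 oz0 Tz0] :=
      @eq_bigmax_cond _ (fun z : 'I_Z => own z != 0) (fun z => (z %/ m).+1).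
      by apply/card_gt0P; exists z1.
    by exists z0.
  by move: T0; rewrite /T big_pred0.
have [|X [N [X0 XN dem]]] := overdemand Z mach el _ valid own price (T.-1 * B) (T * B) z0
    eq _ (ltn_ord z0) oz0 (eq_leq (congr1 (muln^~ B) Tz0)).
  by rewrite -{2}(prednK T0) mulSn addnC ltn_add2r.
have [/existsP[i hi]|/existsPn none] :=
  boolP [exists i : 'I_m, T <= \sum_(j < n) wt j * (h j == i)].
  by exists i.
have B0 : 0 < B by apply: leq_ltn_trans ZB.
(* There are [K] levels in all, so each machine has exactly [T.-1] slots below the top one. *)
have TK : T.-1 <= K.
  rewrite Tz0 /= -ltnS ltnW // ltnS ltn_divLR ?ltn_ord //.
  by apply: leq_ltn_trans (mach_lt _ (ltn_ord z0)).
exfalso; move: dem; rewrite ltnNge => /negP; apply.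
rewrite (s (fun x => X x)) ?X0 //.
apply: (@leq_trans (\sum_(j < n) wt j * N (h j))).
  apply: leq_sum => j _; have [hm he] := ah j (ltn_ord j).
  rewrite leq_mul2l; case: (boolP (X j.+1)) => xj; last by rewrite orbT.
  by rewrite (XN j.+1) ?orbT // elE.
rewrite (sum_split_machine n m h) => [|j jn]; last by have [] := ah j jn.
apply: (@leq_trans (\sum_(i < m) N i * T.-1)).
  by apply: leq_sum => i _; rewrite leq_mul2l; have := none i; lia.
rewrite -big_distrl /= mulnC.
rewrite (eq_bigr (fun z : 'I_Z => (z %/ m < T.-1) * N (z %% m) : nat)); last first.
  by move=> z _; rewrite leq_mul2r gtn_eqF //= machE // mulnb.
rewrite (sum_grid K m (fun t i => (t < T.-1) * N i)).
by rewrite -big_distrlr /= sum_ord_lt (minn_idPr TK).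
Qed.

Let wt1 j := if lg j then k else 1.
Let wt2 j := if lg j then 1 else 0.
Variables own1 own2 price2 ini2 : nat -> nat.
Variable valid2 : pred nat.
Hypothesis own1_el : forall z, z < Z -> own1 z != 0 -> el (own1 z) (mach z).
Hypothesis sells1 : sells own1 wt1.
Hypothesis sells2 : sells own2 wt2.
Hypothesis eq2 : equil Z mach el ini2 valid2 own2 price2.
Let long z := (own1 z != 0) && lg (own1 z).-1.
Hypothesis ini2P : forall z, z < Z -> ini2 z = 0 \/ ini2 z = B.
Hypothesis ini2_count : forall i : nat,
  \sum_(z < Z) ((mach z == i) && long z)
    <= k * \sum_(z < Z) ((mach z == i) && (ini2 z == 0))
    <= \sum_(z < Z) ((mach z == i) && long z) + k.-1.

(* The long units bought in the first auction form a fractional assignment of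
   the long jobs to the initially free slots of the second, so by Hall's
   theorem no other slot is needed. *)
Lemma long_free z : z < Z -> own2 z != 0 -> ini2 z = 0.
Proof.
move=> zZ oz; case: (ini2P z zZ) => // iz; exfalso.
have [X [N [X0 XN]]] := overdemand Z mach el _ valid2 own2 price2 0 B z
    eq2 ZB zZ oz (eq_leq (esym iz)).
rewrite ltnNge => /negP; apply.
have [k0|k0] := posnP k.
  by move: zZ; rewrite /Z /K k0 muln0.
rewrite -(leq_pmul2l k0) (sells2 (fun x => X x)) ?X0 //.
apply: (@leq_trans (\sum_(z < Z) long z * N (mach z))).
  rewrite big_distrr /=.
  (* A long job had [k] units in the first auction, so [k] times the demand of [X] counts its long
     units there; these lie on machines in [N]. *)
  have -> : \sum_(j < n) k * (wt2 j * X j.+1) = \sum_(z < Z) (long z && X (own1 z)).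
    rewrite (sells1 (fun x => (x != 0) && lg x.-1 && X x)) //.
    by apply: eq_bigr => j _ /=; rewrite /wt1 /wt2; case: (lg j); rewrite ?muln0 ?mul0n ?mul1n.
  apply: leq_sum => z' _; rewrite mulnb; case: (boolP (long z')) => //= /andP[o _].
  by case: (boolP (X _)) => // xo; rewrite (XN (own1 z')) // own1_el.
rewrite [X in _ <= _ * X](eq_bigr (fun z : 'I_Z => (ini2 z == 0) * N (mach z))); last first.
  by move=> z' _; rewrite mulnb leqn0.
rewrite (sum_split_machine Z m mach (fun z => long z)); last exact: mach_lt.
rewrite (sum_split_machine Z m mach (fun z => ini2 z == 0)); last exact: mach_lt.
rewrite big_distrr /=; apply: leq_sum => i _; rewrite mulnCA leq_mul2l.
apply/orP; right; have /andP[h _] := ini2_count i.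
rewrite [X in X <= _](eq_bigr
  (fun z : 'I_Z => nat_of_bool ((mach z == i) && long z))); last first.
  by move=> z' _; rewrite mulnb andbC.
apply: leq_trans h _; rewrite leq_mul2l; apply/orP; right.
by apply: leq_sum => z' _; rewrite mulnb andbC.
Qed.

Variable o : nat -> nat.
Hypothesis o_long : forall j, j < n -> lg j ->
  exists z, [/\ z < Z, own2 z = j.+1 & o j = mach z].
Hypothesis o_short : forall j, j < n -> ~~ lg j ->
  exists z, [/\ z < Z, own1 z = j.+1 & o j = mach z].

(** The slack [k.-1] is the rounding error in the number of free slots. The bound without slack
    covers machines with no long job, for which the optimum may be less than 1. *)
Lemma rounded T i :
  \sum_(z < Z) ((own1 z != 0) && (mach z == i)) <= T ->
  k * nlong o i + nshort o i <= T + k.-1 /\ (nlong o i = 0 -> nshort o i <= T).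
Proof.
move=> hT; pose L := \sum_(z < Z) ((mach z == i) && long z).
have hS : L + nshort o i <= T.
  apply: leq_trans hT.
  apply: (@leq_trans (L + \sum_(z < Z)
      ((own1 z != 0) && ~~ lg (own1 z).-1 && (mach z == i)))).
    rewrite leq_add2l /nshort.
    apply: (sum_le_owned n Z own1 (fun j => ~~ lg j && (o j == i))
      (fun z => (own1 z != 0) && ~~ lg (own1 z).-1 && (mach z == i))).
    move=> j jn /andP[lj /eqP oj]; have [z [zZ oz ez]] := o_short j jn lj.
    by exists z; rewrite oz /= lj -ez oj eqxx.
  rewrite -big_split /=; apply: leq_sum => z _; rewrite /long.
  by case: (own1 z != 0); case: (lg _); case: (mach z == i).
have hL : k * nlong o i <= L + k.-1.
  have /andP[_ h] := ini2_count i; apply: leq_trans h; rewrite leq_mul2l.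
  apply/orP; right.
  apply: (sum_le_owned n Z own2 (fun j => lg j && (o j == i))
      (fun z => (mach z == i) && (ini2 z == 0))).
  move=> j jn /andP[lj /eqP oj]; have [z [zZ oz ez]] := o_long j jn lj.
  by exists z; split=> //; rewrite -ez oj eqxx long_free ?oz.
split; last by move=> _; apply: leq_trans hS; exact: leq_addl.
lia.
Qed.
End Rounding.

(** * Correctness of the whole program *)

Definition program (k : nat) : cmd :=
  seqs [:: setup k; phase k 1; out; convert k; phase 1 0; out].

Lemma wp_program X k st (n := st 0 0) (m := st 0 1)
    (e := fun j i => st 0 (2 + n + j * m + i) != 0)
    (lg := fun j => st 0 j.+2 != 0) :
  0 < k -> (forall a i, a != 0 -> st a i = 0) ->
  (forall j, j < n -> exists2 i, i < m & e j i) ->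
  n * k * m * ((n * k).+1 * (n * k * m).+1).+2 <= X ->
  n <= X -> n * k <= X -> k <= X -> (0 < n -> m <= X) ->
  wp X (program k) (fun s => assignment n m e (s 1) /\
    exists T,
      (forall i, k * nlong n lg (s 1) i + nshort n lg (s 1) i <= T + k.-1 /\
                 (nlong n lg (s 1) i = 0 -> nshort n lg (s 1) i <= T)) /\
      (0 < T -> forall h, assignment n m e h ->
         exists2 i, i < m & T <= k * nlong n lg h i + nshort n lg h i)) st.
Proof.
move=> k0 st0 ex_e ZX nX nkX kX mX.
set K := n * k in ZX nkX *; set Z := K * m in ZX *.
pose B := Z.+1; pose PM := K.+1 * B.
have Z_X : Z <= X by apply: leq_trans ZX; exact: leq_pmulr.
apply/wp_seq/wp_frame; apply: wp_mono (wp_setup X k st st0 nX nkX mX).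
move=> s1 []; rewrite -/n -/m -/K -/Z -/B => h5 h9 h7; rewrite h9 -/PM => h8 h43 fr1.
pose inp := st 0; pose bs := s1 5; pose mach := s1 4.
have en1 : env Z PM inp bs mach s1.
  by split=> // i; rewrite fr1.
have machE z : z < Z -> mach z = z %% m by case/h43.
have m0 z : z < Z -> 0 < m by rewrite /Z; case: (m) => //; rewrite muln0.
have elE j i : j < n -> i < m -> el inp bs j.+1 i = e j i.
  by move=> jn im; rewrite /el /bs h5.
have val j : j < n -> valid Z K inp bs mach j.+1.
  move=> jn; have [i im ei] := ex_e j jn.
  (* Each level has a slot of every machine, so one eligible machine already offers [K] slots. *)
  apply: (@leq_trans (\sum_(z < Z) (z %% m == i))).
    rewrite (sum_grid K m (fun _ i' => i' == i)) sum_ord_eq im.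
    by rewrite sum_nat_const card_ord muln1.
  apply: leq_sum => z _; case: eqP => // zi.
  by rewrite machE // zi elE // ei.
pose ini1 z := (z %/ m).+1 * B.
have ini1P z : z < Z -> ini1 z <= PM.
  by move=> zZ; rewrite leq_mul2r ltnS ltnW ?orbT // ltn_divLR ?(m0 z).
have wtK (kl ks : nat) : kl <= k -> ks <= k ->
    \sum_(j < n) (if inp j.+2 != 0 then kl else ks) <= K.
  move=> h1 h2; apply: (@leq_trans (\sum_(j < n) k)); last by rewrite sum_nat_const card_ord.
  by apply: leq_sum => j _; case: ifP.
have X0 : 1 <= X by apply: leq_trans kX.
apply/wp_seq/wp_frame; apply: wp_mono
  (wp_phase X Z PM K inp bs mach ini1 ZX ini1P k 1 s1 en1 _ _ val (wtK _ _ _ _) _ _ _) => //;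
  first last.
- by move=> z /h43[].
- by move=> z _; rewrite fr1 // st0.
move=> s2 [[eq1 pb1] sells1] fr2.
have en2 : env Z PM inp bs mach s2 by exact: env_same en1 fr2 isT.
have [_ _ e24 e27 _] := en2.
apply/wp_seq/wp_frame; apply: wp_mono (wp_out X s2 _); last by rewrite e27.
rewrite e27 => s3 ho1 fr3.
have en3 : env Z PM inp bs mach s3 by exact: env_same en2 fr3 isT.
have [e30 _ e34 e37 _] := en3.
have s39 : s3 9 0 = B by rewrite fr3 // fr2.
apply/wp_seq/wp_frame; apply: wp_mono (wp_convert X k s3 _ k0 _ _); first last.
- by move=> i; rewrite fr3 // fr2 // fr1 // st0.
- by rewrite s39.
- by rewrite e37.
rewrite e37 s39 => s4 [own0 ini2P cnt2] fr4.
have en4 : env Z PM inp bs mach s4 by exact: env_same en3 fr4 isT.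
pose ini2 := s4 3.
have ini2P' z : z < Z -> ini2 z <= PM.
  by rewrite /ini2 => /ini2P[->|->] //; exact: leq_pmull.
apply/wp_seq/wp_frame; apply: wp_mono
  (wp_phase X Z PM K inp bs mach ini2 ZX ini2P' 1 0 s4 en4 own0 _ val (wtK _ _ _ _)
     _ _ _) => //.
move=> s5 [[eq2 pb2] sells2] fr5.
have en5 : env Z PM inp bs mach s5 by exact: env_same en4 fr5 isT.
have [_ _ e54 e57 _] := en5.
apply/wp_seq/wp_frame; apply: wp_mono (wp_out X s5 _); last by rewrite e57.
rewrite e57 => s6 ho2 fr6; apply: wp_skip.
have {}sells1 : sells n m k (s2 2) (fun j => if lg j then k else 1) := sells1.
have {}sells2 : sells n m k (s5 2) (fun j => if lg j then 1 else 0) := sells2.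
have o_long j : j < n -> lg j ->
    exists z, [/\ z < Z, s5 2 z = j.+1 & s6 1 j = mach z].
  move=> jn lj; case: (ho2 j) => [[z [z1 z2 z3]]|[h _]].
    by exists z; rewrite -e54.
  have [|z zZ oz] := sells_ex n m k _ _ j sells2 jn; first by rewrite lj.
  by have := h z zZ; rewrite oz eqxx.
have o_short j : j < n -> ~~ lg j ->
    exists z, [/\ z < Z, s2 2 z = j.+1 & s6 1 j = mach z].
  move=> jn lj; case: (ho2 j) => [[z [z1 z2 z3]]|[_ ->]].
    (* A short job has weight 0 in the second auction and cannot own a slot there. *)
    have := sells_count n m k _ _ j sells2 jn; rewrite (negPf lj).
    by rewrite (bigD1 (Ordinal z1)) //= z2 eqxx.
  rewrite fr5 // fr4 //; case: (ho1 j) => [[z [z1 z2 z3]]|[h _]].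
    by exists z; rewrite -e24.
  have [|z zZ oz] := sells_ex n m k _ _ j sells1 jn; first by rewrite (negPf lj).
  by have := h z zZ; rewrite oz eqxx.
have own_el own price ini : equil Z mach (el inp bs) ini (valid Z K inp bs mach) own price ->
    forall z, z < Z -> own z != 0 -> el inp bs (own z) (mach z).
  by move=> eq z zZ; have := eq z zZ; case: eqP => // _ [].
split.
  move=> j jn.
  have [z [zZ -> ez]] : exists z, [/\ z < Z, s6 1 j = mach z & el inp bs j.+1 (mach z)].
    case: (boolP (lg j)) => lj.
      have [z [zZ oz ->]] := o_long j jn lj; exists z; split=> //.
      by rewrite -oz; apply: own_el eq2 _ zZ _; rewrite oz.
    have [z [zZ oz ->]] := o_short j jn lj; exists z; split=> //.
    by rewrite -oz; apply: own_el eq1 _ zZ _; rewrite oz.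
  have lt : mach z < m by rewrite machE // ltn_mod (m0 z).
  by rewrite -elE.
have [T [leT optT]] := units_opt n m k e mach (el inp bs) B machE elE (leqnn _)
  _ _ _ _ eq1 sells1.
exists T; split.
  move=> i; apply: (rounded n m k lg mach (el inp bs) B machE (leqnn _)
    (s2 2) (s5 2) (s5 3) ini2 _ (own_el _ _ _ eq1) sells1 sells2 eq2 ini2P _ (s6 1)
    o_long o_short T i (leT i)).
  have lgE z : (s3 2 z != 0) && (s3 0 (s3 2 z).+1 != 0) = (s2 2 z != 0) && lg (s2 2 z).-1.
    by rewrite fr3 // e30 /lg; case: (s2 2 z).
  move=> i'; have := cnt2 i'.
  under eq_bigr do rewrite e34 lgE.
  have -> : \sum_(z < Z) ((s3 4 z == i') && (s4 3 z == 0)) =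
            \sum_(z < Z) ((mach z == i') && (ini2 z == 0))
    by apply: eq_bigr => z _; rewrite e34.
  by [].
move=> T0 h ah; have [i im hi] := optT T0 h ah; exists i => //; apply: leq_trans hi _.
rewrite /nlong /nshort big_distrr -big_split /=; apply: leq_sum => j _.
by case: (lg j) => /=; rewrite ?addn0 ?mul1n ?muln0.
Qed.

(** * Reading the instance off the input word *)

Lemma nth_allpairs (S T : Type) (U : Type) (f : S -> T -> U) s t x0 y0 z0 p q :
  p < size s -> q < size t ->
  nth z0 [seq f x y | x <- s, y <- t] (p * size t + q) = f (nth x0 s p) (nth y0 t q).
Proof.
move=> ps qt; elim: s p ps => [//|x s IH] [|p] ps /=; rewrite nth_cat size_map.
  by rewrite qt (nth_map y0).
by rewrite mulSn -addnA ltnNge leq_addr addKn IH.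
Qed.

Section Encoding.
Variables (R : realType) (I : instance R).
Let n := njobs I.
Let m := nmachines I.
Let st := init (encode I).

Lemma size_encode : size (encode I) = 2 + n + n * m.
Proof.
by rewrite /encode !size_cat size_map size_allpairs !size_enum_ord addnA.
Qed.

Lemma encode_long (j : 'I_n) : (st 0 j.+2 != 0) = (ptime I j == 1%R).
Proof.
rewrite /st /init /= nth_cat size_map size_enum_ord ltn_ord.
by rewrite (nth_map j) ?size_enum_ord // nth_ord_enum eqb0 negbK.
Qed.

Lemma encode_elig (j : 'I_n) (i : 'I_m) :
  (st 0 (2 + n + j * m + i) != 0) = (i \in elig I j).
Proof.
rewrite /st /init /= nth_cat size_map size_enum_ord -/n.
rewrite ltnNge -addnA leq_addr addKn.
have := nth_allpairs _ _ _ (fun (j : 'I_n) (i : 'I_m) => nat_of_bool (i \in elig I j))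
  (enum 'I_n) (enum 'I_m) j i 0 j i.
rewrite !size_enum_ord => -> //.
by rewrite !nth_ord_enum eqb0 negbK.
Qed.

End Encoding.

Local Open Scope ring_scope.

(** * Loads and the optimal makespan *)

Section Loads.
Variables (R : realType) (I : instance R) (alpha : R).
Hypothesis ptimeP : forall j, ptime I j = 1 \/ ptime I j = 1 / alpha.
Let n := njobs I.
Let m := nmachines I.
Variable lg : pred nat.
Hypothesis lgE : forall j : 'I_n, lg j = (ptime I j == 1).

Lemma load_split (s : schedule I) (h : nat -> nat) (i : 'I_m) :
  (forall j : 'I_n, h j = s j) ->
  load I s i = (nlong n lg h i)%:R + (nshort n lg h i)%:R / alpha.
Proof.
move=> hs; rewrite /load /nlong /nshort !natr_sum mulr_suml -big_split /=.
rewrite big_mkcond /=; apply: eq_bigr => j _.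
rewrite hs lgE val_eqE; case: (s j == i); last by rewrite !andbF mul0r addr0.
rewrite !andbT; case: eqP => [->|ne] /=; first by rewrite mul0r addr0.
by case: (ptimeP j) => // ->; rewrite add0r.
Qed.

Lemma load_le_makespan (s : schedule I) i : load I s i <= makespan I s.
Proof. exact: le_bigmax. Qed.

Lemma makespan_ge0 (s : schedule I) : 0 <= makespan I s.
Proof. exact: bigmax_ge_id. Qed.

Lemma opt_ge1 (j : 'I_n) : lg j -> 1 <= opt_makespan I.
Proof.
rewrite lgE => /eqP pj; have [s _ ->] := opt_makespan_attained I.
apply: le_trans (load_le_makespan s (s j)).
rewrite /load (bigD1 j) //= pj lerDl; apply: sumr_ge0 => i _; exact: ptime_ge0.
Qed.

End Loads.

(** * The two approximation ratios *)

Section Arithmetic.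
Variables (R : realType) (alpha : R).
Hypothesis alpha_gt1 : 1 < alpha.

(** Since [k <= alpha], [T <= alpha * opt]. If [a > 0], then [k * (a + b / alpha) <= k * a + b <= T
    + k - 1 <= (alpha + k - 1) * opt], the last step by [1 <= opt]. *)
Lemma ratio_floor (k : nat) (T a b a' b' : nat) (opt : R) :
  (0 < k)%N -> k%:R <= alpha -> (T <= k * a' + b')%N ->
  a'%:R + b'%:R / alpha <= opt ->
  (k * a + b <= T + k.-1)%N -> (a = 0%N -> b <= T)%N -> ((0 < a)%N -> 1 <= opt) ->
  a%:R + b%:R / alpha <= (alpha / k%:R + 1 - 1 / k%:R) * opt.
Proof.
move=> k0 ka hT hopt hab ha0 ha1.
have al0 : 0 < alpha := lt_trans ltr01 alpha_gt1.
have kR : 0 < k%:R :> R by rewrite ltr0n.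
have k1 : 1 <= k%:R :> R by rewrite ler1n.
have {}hT : T%:R <= k%:R * a'%:R + b'%:R :> R by rewrite -natrM -natrD ler_nat.
have hTo : T%:R <= opt * alpha.
  apply: le_trans hT _; rewrite -ler_pdivrMr // mulrDl.
  apply: le_trans hopt; rewrite lerD2r mulrAC ler_piMl ?ler0n //.
  by rewrite ler_pdivrMr // mul1r.
have [a0|a1] := posnP a.
  have b_T : b%:R <= T%:R :> R by rewrite ler_nat ha0.
  rewrite a0 add0r ler_pdivrMr //; apply: le_trans (le_trans b_T hTo) _.
  rewrite ler_pM2r //.
  have o0 : 0 <= opt by apply: le_trans hopt; rewrite addr_ge0 ?divr_ge0 ?ler0n ?ltW.
  rewrite ler_peMl //.
  have -> : alpha / k%:R + 1 - 1 / k%:R = 1 + (alpha - 1) / k%:R by rewrite mulrBl; ring.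
  by rewrite lerDl divr_ge0 ?ltW // subr_gt0.
have {}hab : k%:R * a%:R + b%:R <= T%:R + (k%:R - 1) :> R.
  rewrite -[X in _ - X]/(1%:R) -natrB // -natrM -!natrD ler_nat; lia.
have o1 := ha1 a1.
have -> : alpha / k%:R + 1 - 1 / k%:R = (alpha + (k%:R - 1)) / k%:R.
  by field; rewrite gt_eqF.
rewrite mulrAC ler_pdivlMr // mulrDl.
have hb : b%:R / alpha * k%:R <= b%:R.
  by rewrite mulrAC ler_pdivrMr // ler_wpM2l.
nra.
Qed.

(** Since [alpha <= k], [T <= k * opt]. If [a > 0], lowering the weight of a long job from [k] to
    [alpha] saves at least [k - alpha], so [alpha * a + b <= T + alpha - 1 <= (k + alpha - 1) *
    opt]. *)
Lemma ratio_ceil (k : nat) (T a b a' b' : nat) (opt : R) :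
  (0 < k)%N -> alpha <= k%:R -> (T <= k * a' + b')%N ->
  a'%:R + b'%:R / alpha <= opt ->
  (k * a + b <= T + k.-1)%N -> (a = 0%N -> b <= T)%N -> ((0 < a)%N -> 1 <= opt) ->
  a%:R + b%:R / alpha <= (1 + k%:R / alpha - 1 / alpha) * opt.
Proof.
move=> k0 ka hT hopt hab ha0 ha1.
have al0 : 0 < alpha := lt_trans ltr01 alpha_gt1.
have kR : 0 < k%:R :> R by rewrite ltr0n.
have {}hT : T%:R <= k%:R * a'%:R + b'%:R :> R by rewrite -natrM -natrD ler_nat.
have o0 : 0 <= opt by apply: le_trans hopt; rewrite addr_ge0 ?divr_ge0 ?ler0n ?ltW.
have hTo : T%:R <= opt * k%:R.
  apply: le_trans hT _; rewrite -ler_pdivrMr // mulrDl.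
  apply: le_trans hopt; rewrite mulrAC divff ?gt_eqF // mul1r lerD2l.
  by rewrite ler_wpM2l ?ler0n // lef_pV2.
have -> : 1 + k%:R / alpha - 1 / alpha = (alpha + k%:R - 1) / alpha.
  by field; rewrite gt_eqF.
rewrite mulrAC ler_pdivlMr // mulrDl mulfVK ?gt_eqF //.
have [a0|a1] := posnP a.
  have b_T : b%:R <= T%:R :> R by rewrite ler_nat ha0.
  by rewrite a0 mul0r add0r; have al1 := alpha_gt1; nra.
have {}hab : k%:R * a%:R + b%:R <= T%:R + (k%:R - 1) :> R.
  rewrite -[X in _ - X]/(1%:R) -natrB // -natrM -!natrD ler_nat; lia.
have o1 := ha1 a1.
have a1R : 1 <= a%:R :> R by rewrite ler1n.
have al1 := alpha_gt1; nra.
Qed.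

End Arithmetic.

(** * Polynomial running time and conclusion *)

(** Brings [tm_poly] into the form of a constant times a power of [S]; the power of 2 absorbs the
    successor in [X.+1]. *)
Lemma tm_cubic c b S : (0 < b * S ->
  tm ((b * S) ^ 3) c
  <= csize c * 2 ^ depth c * b ^ (3 * depth c) * S ^ (3 * depth c))%N.
Proof.
move=> bS; apply: leq_trans (tm_poly _ c) _; move: (depth c) => d.
rewrite -!mulnA leq_mul2l -expnMn expnM -expnMn; apply/orP; right.
case: d => // d; rewrite leq_exp2r // mul2n -addnn -addn1 leq_add2l.
by rewrite expn_gt0 bS.
Qed.

Definition fun_of_schedule (R : realType) (I : instance R) (s : schedule I)
  (j : nat) : nat := if insub j is Some j' then s j' else 0%N.

Lemma fun_of_scheduleE (R : realType) (I : instance R) (s : schedule I) j :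
  fun_of_schedule R I s (nat_of_ord j) = s j.
Proof. by rewrite /fun_of_schedule valK. Qed.

Lemma poly_time_ratio (R : realType) (alpha rho : R) (k : nat) :
  1 < alpha -> (0 < k)%N ->
  (forall (T a b a' b' : nat) (opt : R), (T <= k * a' + b')%N ->
     a'%:R + b'%:R / alpha <= opt ->
     (k * a + b <= T + k.-1)%N -> (a = 0%N -> b <= T)%N -> ((0 < a)%N -> 1 <= opt) ->
     a%:R + b%:R / alpha <= rho * opt) ->
  poly_time_solvable
    (fun I : instance R => forall j, ptime I j = 1 \/ ptime I j = 1 / alpha)
    (fun I : instance R => encode I)
    (fun (I : instance R) (output : seq nat) =>
       exists s : schedule I,
         [/\ output = encode_schedule I s, feasible I s
           & makespan I s <= rho * opt_makespan I]).
Proof.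
move=> alpha_gt1 k0 ratio.
pose c := program k; pose d := depth c.
pose C := (csize c * 2 ^ d * (k + 3) ^ (3 * d))%N.
(* A single number must serve as coefficient and as exponent, so the constant and the degree are
   added. *)
exists c, (C + 3 * d)%N => I ptimeP.
pose n := njobs I; pose m := nmachines I; pose S := size (encode I).
have SE : S = (2 + n + n * m)%N by exact: size_encode.
(* The number of purchases is bounded by slots times the highest price, itself about levels times
   price step: three factors of size at most [(k + 3) * S]. *)
pose X := (((k + 3) * S) ^ 3)%N.
have S2 : (2 <= S)%N by rewrite SE; lia.
have nS : (n <= S)%N by rewrite SE; lia.
have nmS : (n * m <= S)%N by rewrite SE; lia.
pose q := ((k + 3) * S)%N.
have q0 : (0 < q)%N by rewrite /q; nia.
have qX : (q <= X)%N by rewrite /X -/q; apply: (@leq_pexp2l q 1 3).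
have nkq : (n * k + 2 <= q)%N by rewrite /q; nia.
have nkmq : (n * k * m + 2 <= q)%N by rewrite /q; nia.
have ex_e j : (j < n)%N -> exists2 i, (i < m)%N &
    init (encode I) 0 (2 + n + j * m + i) != 0%N.
  move=> jn; have /set0Pn[i ei] := elig_neq0 I (Ordinal jn).
  by exists i => //; rewrite (encode_elig R I (Ordinal jn) i).
have nX : (n <= X)%N by apply: leq_trans qX; rewrite /q; nia.
have nkX : (n * k <= X)%N by apply: leq_trans qX; lia.
have [||||||st [t [ex tX [asn [T [leT optT]]]]]] :=
  wp_program X k (init (encode I)) k0 _ ex_e.
- by move=> a i a0; rewrite /init (negPf a0).
- rewrite /X !expnS expn0 muln1 -/q /=.
  move: nkq nkmq; set u := (n * k)%N; set v := (u * m)%N => h1 h2.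
  apply: leq_mul; first lia.
  apply: (@leq_trans ((q - 1) * (q - 1) + 2)%N).
    by rewrite addn2 !ltnS; apply: leq_mul; lia.
  have : (2 <= q)%N by lia.
  by case: (q) => [|[|p]] // _; rewrite !subn1 /=; lia.
- exact: nX.
- exact: nkX.
- by apply: leq_trans qX; rewrite /q; nia.
- move=> n0; apply: leq_trans qX; apply: (@leq_trans S); last by rewrite /q; nia.
  by apply: leq_trans nmS; exact: leq_pmull.
pose lg := fun j => init (encode I) 0 j.+2 != 0%N.
have lgE (j : 'I_n) : lg j = (ptime I j == 1) by exact: encode_long.
pose s : schedule I := [ffun j : 'I_n => Ordinal (asn j (ltn_ord j)).1].
have sE (j : 'I_n) : st 1%N j = s j by rewrite ffunE.
exists (encode_schedule I s), t; split.
- exists st => // i; rewrite size_map size_enum_ord => iN.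
  by rewrite (nth_map (Ordinal iN)) ?size_enum_ord // (nth_ord_enum _ (Ordinal iN)) -sE.
- have q3 := tm_cubic c (k + 3) S q0; apply: leq_trans tX (leq_trans q3 _).
  rewrite -/d -/C; apply: leq_trans (leq_addr _ _).
  apply: leq_mul; first exact: leq_addr.
  by rewrite leq_pexp2l ?leq_addl // (leq_trans _ S2).
exists s; split=> //.
- apply/forallP => j; have [lt e] := asn j (ltn_ord j).
  by rewrite -(encode_elig R I) -sE.
have [so fso optE] := opt_makespan_attained I.
have opt0 : 0 <= opt_makespan I by rewrite optE; exact: makespan_ge0.
(* For positive [T] the witnesses come from a machine that an optimal schedule loads with at least
   [T] units; for [T = 0] zeros will do. *)
have [a' [b' [hT hopt]]] : exists a' b' : nat, (T <= k * a' + b')%N /\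
    a'%:R + b'%:R / alpha <= opt_makespan I.
  have [T0|T0] := posnP T; first by exists 0%N, 0%N; rewrite T0 mul0r addr0.
  pose h := fun_of_schedule R I so.
  have [|i im hi] := optT T0 h.
    move=> j jn; have -> : h j = so (Ordinal jn) := fun_of_scheduleE R I so (Ordinal jn).
    by split=> //; rewrite (encode_elig R I (Ordinal jn)); exact: (forallP fso).
  exists (nlong n lg h i), (nshort n lg h i); split=> //.
  rewrite -(load_split R I alpha ptimeP lg lgE so h (Ordinal im)) ?optE.
    exact: load_le_makespan.
  exact: fun_of_scheduleE.
apply: bigmax_le => [|i _].
  (* The default 0 of the maximum must obey the bound too; [ratio] at zero loads gives this without
     knowing the sign of [rho]. *)
  have := ratio 0%N 0%N 0%N 0%N 0%N (opt_makespan I) isT.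
  by rewrite mul0r addr0 muln0; apply.
rewrite (load_split R I alpha ptimeP lg lgE s (st 1%N) i sE).
have [leT1 leT2] := leT i.
apply: ratio hT hopt leT1 leT2 _.
rewrite /nlong lt0n sum_nat_eq0 negb_forall => /existsP[j].
by rewrite -/(lg j); case: (boolP (lg j)) => [lj _|//]; exact: (opt_ge1 R I lg lgE j lj).
Qed.

Theorem theorem1 (R : realType) (alpha : R) (alpha_gt1 : 1 < alpha) :
  poly_time_solvable
    (fun I : instance R => forall j, ptime I j = 1 \/ ptime I j = 1 / alpha)
    (fun I : instance R => encode I)
    (fun (I : instance R) (output : seq nat) =>
       exists s : schedule I,
         [/\ output = encode_schedule I s,
             feasible I s
           & makespan I s <=
             Num.min
               (1 + (Num.ceil alpha)%:~R / alpha - 1 / alpha)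
               (alpha / (Num.floor alpha)%:~R + 1
                - 1 / (Num.floor alpha)%:~R)
             * opt_makespan I]).
Proof.
have al0 : 0 < alpha := lt_trans ltr01 alpha_gt1.
have [f fE] : exists f : nat, Num.floor alpha = f.
  by exists `|Num.floor alpha|%N; rewrite gez0_abs // floor_ge0 ltW.
have [g gE] : exists g : nat, Num.ceil alpha = g.
  by exists `|Num.ceil alpha|%N; rewrite gez0_abs // ltW // ceil_gt0.
have f_le : f%:R <= alpha by have := floor_le alpha; rewrite fE.
have g_ge : alpha <= g%:R by have := ceil_ge alpha; rewrite gE.
have f0 : (0 < f)%N.
  have : 1%:Z <= Num.floor alpha by rewrite floor_ge_int ltW.
  by rewrite fE.
have g0 : (0 < g)%N by rewrite -(ltr0n R); exact: lt_le_trans g_ge.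
(* As [alpha] is fixed, the smaller bound is known before any input is read, and the value of [k]
   can be built into the program. *)
rewrite fE gE -!pmulrn; case: leP => _.
- apply: (poly_time_ratio R alpha _ g) => // T a b a' b' opt.
  exact: (ratio_ceil R alpha alpha_gt1 g T a b a' b' opt g0 g_ge).
- apply: (poly_time_ratio R alpha _ f) => // T a b a' b' opt.
  exact: (ratio_floor R alpha alpha_gt1 f T a b a' b' opt f0 f_le).
Qed.
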